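(* Let $m\le n$, let $f:\mathbb{R}^n\to\mathbb{R}$ and $h:\mathbb{R}^n\to\mathbb{R}^m$ be continuously differentiable, let $\lambda_h>0$, and define $\mathcal{L}:\mathbb{R}^n\to\mathbb{R}$ by $\mathcal{L}(x)=f(x)+\lambda_h\|h(x)\|^2$. Let $p:\mathbb{R}^m\to\mathbb{R}^{n-m}$ satisfy $h([\theta^T\;\;p(\theta)^T]^T)=0$ for all $\theta\in\mathbb{R}^m$, and define $l:\mathbb{R}^m\to\mathbb{R}$ by $l(\theta)=\mathcal{L}([\theta^T\;\;p(\theta)^T]^T)=f([\theta^T\;\;p(\theta)^T]^T)$. Assume that there exists a convex set $\Omega_n\subseteq\mathbb{R}^n$ such that $f$ and $h$ are convex on $\Omega_n$, and let $$\Omega_m=\{\theta\in\mathbb{R}^m \mid \theta=x_{1:m},\ x\in\Omega_n\}.$$ If either of the following conditions is satisfied: (i) $\nabla\mathcal{L}(x)\ge0$ for all $x\in\Omega_n$, and $p$ is convex on $\Omega_m$; (ii) $\nabla\mathcal{L}(x)\le0$ for all $x\in\Omega_n$, and $p$ is concave on $\Omega_m$; then $l$ is convex on $\Omega_m$.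
   Context: $\|\cdot\|$ denotes the 2-norm. Inequalities between vectors are understood elementwise, and convexity/concavity of vector-valued functions ($h$, $p$) is understood componentwise. For $x\in\mathbb{R}^n$, $x_{1:m}$ denotes the subvector consisting of the first $m$ entries of $x$.
   Formalization: The formal theorem additionally assumes that [θ; p(θ)] lies in Ω_n for every θ in Ω_m; without this the claim is false (m=1, n=2, h=0, f(t,y)=−(ty)², Ω_n={y=0}, p=1 gives l(t)=−t²). *)

(* Defs.v *)
From HB Require Import structures.
From mathcomp Require Import all_boot all_order all_algebra.
From mathcomp Require Import all_classical all_reals all_analysis.
Set Implicit Arguments.
Unset Strict Implicit.
Unset Printing Implicit Defensive.
Import Order.TTheory GRing.Theory Num.Theory.
Import numFieldNormedType.Exports.
Local Open Scope classical_set_scope.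
Local Open Scope ring_scope.

(* The library norm `|x| on 'rV[R]_n is the max-norm; this is the 2-norm. *)
Definition norm2 (R : realType) (n : nat) (x : 'rV[R]_n) : R :=
  Num.sqrt (\sum_(i < n) x 0 i ^+ 2).

(* Continuity of x |-> 'd f x is required pointwise in the direction v; on a
   finite-dimensional domain this is continuity in operator norm. *)
Definition continuously_differentiable (R : realType) (V W : normedModType R)
    (f : V -> W) : Prop :=
  (forall x : V, differentiable f x) /\
  (forall v : V, continuous (fun x : V => 'd f x v)).

Definition gradient (R : realType) (n : nat) (f : 'rV[R]_n -> R)
    (x : 'rV[R]_n) : 'rV[R]_n :=
  \row_(i < n) 'D_(delta_mx 0 i) f x.

Definition le_vec (R : realType) (n : nat) (u v : 'rV[R]_n) : Prop :=
  forall i : 'I_n, u 0 i <= v 0 i.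

Definition convex_vec (R : realType) (n q : nat) (D : set 'rV[R]_n)
    (g : 'rV[R]_n -> 'rV[R]_q) : Prop :=
  forall i : 'I_q, convex_function D (fun x => g x 0 i).

Definition concave_vec (R : realType) (n q : nat) (D : set 'rV[R]_n)
    (g : 'rV[R]_n -> 'rV[R]_q) : Prop :=
  convex_vec D (fun x => - g x).

Definition penalized (R : realType) (n m : nat) (f : 'rV[R]_n -> R)
    (h : 'rV[R]_n -> 'rV[R]_m) (lambda : R) (x : 'rV[R]_n) : R :=
  f x + lambda * norm2 (h x) ^+ 2.

(* R^n with m <= n is 'rV_(m + k), where k = n - m; row_mx and lsubmx are then
   stacking [theta; p theta] and extraction of the first m entries. *)
Definition reduced (R : realType) (m k : nat) (f : 'rV[R]_(m + k) -> R)
    (h : 'rV[R]_(m + k) -> 'rV[R]_m) (lambda : R)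
    (p : 'rV[R]_m -> 'rV[R]_k) (theta : 'rV[R]_m) : R :=
  penalized f h lambda (row_mx theta (p theta)).

Definition projection (R : realType) (m k : nat) (D : set 'rV[R]_(m + k)) :
    set 'rV[R]_m :=
  [set theta | exists2 x, D x & theta = lsubmx x].

(* Main.v *)
Require Import Defs.
From HB Require Import structures.
From mathcomp Require Import all_boot all_order all_algebra.
From mathcomp Require Import all_classical all_reals all_analysis.
From mathcomp Require Import ring lra.
Set Implicit Arguments.
Unset Strict Implicit.
Unset Printing Implicit Defensive.
Import Order.TTheory GRing.Theory Num.Theory.
Import numFieldNormedType.Exports.
Local Open Scope classical_set_scope.
Local Open Scope ring_scope.

(* At a point of the graph of p the penalty vanishes to second order, so there
   the gradient of the penalized objective is the gradient of f, and f lies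
   above its tangent at that point. Average the tangent inequality at
   z = [theta; p theta] over the two endpoints x, y: what is left is the
   slope of f at z along t x + (1 - t) y - z, whose first m entries are zero
   and whose last k entries have the sign of the gradient of f, by convexity
   (resp. concavity) of p. *)

(** For [0 < s <= 1], convexity bounds the difference quotient at x along y - x by f y - f x.
    Convexity says nothing about s < 0, so the bound is passed to the limit from the right. *)
Lemma convex_function_derive (R : realType) (E : normedModType R) (D : set E)
    (f : E -> R) (x y : E) :
  convex_function D f -> D x -> D y -> derivable f x (y - x) ->
  f x + 'D_(y - x) f x <= f y.
Proof.
move=> fD Dx Dy df; rewrite -lerBrDl.
apply: (cvgr_to_le (cvg_dnbhs_at_right df)).
near=> s.
have s0 : 0 < s by near: s; exact: nbhs_right_gt.
have s1 : s <= 1 by near: s; apply: nbhs_right_le.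
(* The weight s goes with y, so that s tending to 0 approaches x. *)
have fs : f (s *: y + (1 - s) *: x) <= s * f y + (1 - s) * f x.
  have := fD (Itv01 (ltW s0) s1) y x.
  by rewrite !inE; apply.
have -> : (f \o shift x) (s *: (y - x)) = f (s *: y + (1 - s) *: x).
  by rewrite /= scalerBr scalerBl scale1r addrA addrAC.
rewrite -[_ *: _]/(s^-1 * _) ler_pdivrMl//.
lra.
Unshelve. all: by end_near. Qed.

Lemma derive_gradient (R : realType) (n : nat) (f : 'rV[R]_n -> R)
    (x v : 'rV[R]_n) :
  differentiable f x -> 'D_v f x = \sum_(i < n) v 0 i * gradient f x 0 i.
Proof.
move=> df; rewrite deriveE// {1}(row_sum_delta v) linear_sum.
by apply: eq_bigr => i _; rewrite linearZ /= mxE deriveE.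
Qed.

(** Squaring cancels the root in [norm2], so the penalty is a sum of squares of the entries of h;
    each term of its derivative keeps a factor h_i(x) = 0. *)
Lemma derive_penalized (R : realType) (n m : nat) (f : 'rV[R]_n -> R)
    (h : 'rV[R]_n -> 'rV[R]_m) (lambda : R) (x v : 'rV[R]_n) :
  differentiable f x -> differentiable h x -> h x = 0 ->
  'D_v (penalized f h lambda) x = 'D_v f x.
Proof.
move=> df dh hx0.
have -> : penalized f h lambda =
    f + lambda *: \sum_(i < m) (fun y => h y 0 i) ^+ 2.
  apply/funext => y; rewrite /penalized /norm2 sqr_sqrtr.
    by rewrite [RHS]/= fct_sumE.
  by apply: sumr_ge0 => i _; exact: sqr_ge0.
have dfv : is_derive x v f ('D_v f x) by exact/derivableP/diff_derivable.
have dhi i : is_derive x v (fun y => h y 0 i) ('D_v (fun y => h y 0 i) x).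
  apply/derivableP/diff_derivable.
  exact: (differentiable_comp dh (differentiable_coord _ _ _)).
rewrite derive_val big1 ?scaler0 ?addr0// => i _.
by rewrite hx0 mxE expr1 mulr0 scale0r.
Qed.

(** This carries the sign conditions over to f, for which the tangent inequality is available. *)
Lemma gradient_penalized (R : realType) (n m : nat) (f : 'rV[R]_n -> R)
    (h : 'rV[R]_n -> 'rV[R]_m) (lambda : R) (x : 'rV[R]_n) :
  differentiable f x -> differentiable h x -> h x = 0 ->
  gradient (penalized f h lambda) x = gradient f x.
Proof. by move=> df dh h0; apply/rowP => i; rewrite !mxE derive_penalized. Qed.

Lemma convex_function_gradient (R : realType) (n : nat) (D : set 'rV[R]_n)
    (f : 'rV[R]_n -> R) (x y : 'rV[R]_n) :
  convex_function D f -> D x -> D y -> differentiable f x ->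
  f x + \sum_(i < n) (y - x) 0 i * gradient f x 0 i <= f y.
Proof.
move=> fD Dx Dy df; rewrite -derive_gradient//.
by apply: (convex_function_derive fD) => //; exact: diff_derivable.
Qed.

Lemma penalized_feasible (R : realType) (n m : nat) (f : 'rV[R]_n -> R)
    (h : 'rV[R]_n -> 'rV[R]_m) (lambda : R) (x : 'rV[R]_n) :
  h x = 0 -> penalized f h lambda x = f x.
Proof.
move=> h0; rewrite /penalized /norm2 h0 big1 ?sqrtr0 ?expr0n ?mulr0 ?addr0//.
by move=> i _; rewrite mxE expr0n.
Qed.

Theorem mainTheorem4 (R : realType) (m k : nat)
    (f : 'rV[R]_(m + k) -> R) (h : 'rV[R]_(m + k) -> 'rV[R]_m) (lambda : R)
    (p : 'rV[R]_m -> 'rV[R]_k) (Omega : set 'rV[R]_(m + k))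
    (f_C1 : continuously_differentiable f)
    (h_C1 : continuously_differentiable h)
    (lambda_gt0 : 0 < lambda)
    (hp0 : forall theta : 'rV[R]_m, h (row_mx theta (p theta)) = 0)
    (Omega_convex : convex_set Omega)
    (f_convex : convex_function Omega f)
    (h_convex : convex_vec Omega h)
    (graph_sub : forall theta : 'rV[R]_m,
       projection Omega theta -> Omega (row_mx theta (p theta)))
    (monotone :
       ((forall x, Omega x -> le_vec 0 (gradient (penalized f h lambda) x)) /\
        convex_vec (projection Omega) p) \/
       ((forall x, Omega x -> le_vec (gradient (penalized f h lambda) x) 0) /\
        concave_vec (projection Omega) p)) :
  convex_function (projection Omega) (reduced f h lambda p).
Proof.
move=> t a b; rewrite !inE => Pa Pb.
rewrite /reduced !penalized_feasible//.
pose theta : 'rV[R]_m :=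
  t%:num *: (a : 'rV[R]_m) + (1 - t%:num) *: (b : 'rV[R]_m).
pose x := row_mx a (p a); pose y := row_mx b (p b).
pose z := row_mx theta (p theta).
change (f z <= t%:num * f x + (1 - t%:num) * f y).
have Ox : Omega x by exact: graph_sub.
have Oy : Omega y by exact: graph_sub.
have Oz : Omega z.
  (* In general z is not on the segment from x to y. The point of that segment with weight t lies in
     [Omega] and has theta as its first m entries, which puts theta in the projection. *)
  apply: graph_sub; exists (t%:num *: x + (1 - t%:num) *: y).
    by have := Omega_convex x y t; rewrite !inE; apply.
  by rewrite linearD !linearZ /= !row_mxKl.
have [dfz dhz] : differentiable f z /\ differentiable h z.
  by split; [exact: f_C1.1 | exact: h_C1.1].
have slope_ge0 i : 0 <= (t%:num * (x - z) 0 i + (1 - t%:num) * (y - z) 0 i)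
    * gradient f z 0 i.
  rewrite -(gradient_penalized lambda dfz dhz (hp0 _)).
  have : t%:num * (x - z) 0 i + (1 - t%:num) * (y - z) 0 i
      = t%:num * x 0 i + (1 - t%:num) * y 0 i - z 0 i by rewrite !mxE; ring.
  move=> ->; rewrite -(splitK i); case: (fintype.split i) => j /=.
    by rewrite !row_mxEl !mxE subrr mul0r.
  rewrite !row_mxEr.
  (* Under (i) both factors are nonnegative, under (ii) both are nonpositive; either way the product
     is nonnegative. *)
  case: monotone => -[grad pconv].
    have := grad _ Oz (rshift m j); rewrite mxE => g0.
    apply: mulr_ge0 => //; rewrite subr_ge0.
    by have := pconv j t a b; rewrite !inE; apply.
  have := grad _ Oz (rshift m j); rewrite [leRHS]mxE => g0.
  apply: mulr_le0 => //; rewrite subr_le0.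
  have : (- p theta) 0 j <= t%:num * (- p a) 0 j + (1 - t%:num) * (- p b) 0 j.
    by have := pconv j t a b; rewrite !inE; apply.
  by rewrite !mxE !mulrN -opprD lerN2.
have {}slope_ge0 : 0 <= t%:num * (\sum_i (x - z) 0 i * gradient f z 0 i)
    + (1 - t%:num) * (\sum_i (y - z) 0 i * gradient f z 0 i).
  rewrite !mulr_sumr -big_split; apply: sumr_ge0 => i _ /=.
  by have := slope_ge0 i; rewrite mulrDl -!mulrA.
have fx := convex_function_gradient f_convex Oz Ox dfz.
have fy := convex_function_gradient f_convex Oz Oy dfz.
have t0 : 0 <= t%:num by [].
have t1 : 0 <= 1 - t%:num by rewrite subr_ge0.
(* The weights add up to 1, so the sum of the scaled tangent inequalities has f z plus the averaged
   slope on its left side. *)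
have := ler_wpM2l t0 fx; have := ler_wpM2l t1 fy.
move: slope_ge0; lra.
Qed.
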